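(* Let $n\ge1$, $k>\ell\ge1$ and $s\ge1$ be integers, let $d=\gcd(s,n)$, and let $C=\{0,s\}\subseteq\mathbb{Z}/n\mathbb{Z}$. Let $\delta=\gcd(n,k-\ell)$ and let $r\in\{0,\dots,\delta-1\}$ be the remainder of $-k\left\lfloor\frac{n+2(s-1)}{k+\ell}\right\rfloor+(s-1)$ modulo $\delta$. Then \[ \mu^{\{0,s\}}_{k,\ell}(\mathbb{Z}/n\mathbb{Z})\ \ge\ \max\left\{\max_{e\mid d}\left\{\mu_{k,\ell}(\mathbb{Z}/e\mathbb{Z})\cdot\frac{n}{e}\right\},\ \left\lfloor\frac{n+2(s-1)-r}{k+\ell}\right\rfloor-(s-1)\right\} \] and \[ \mu^{\{0,s\}}_{k,\ell}(\mathbb{Z}/n\mathbb{Z})\ \le\ \max\left\{\max_{e\mid d}\left\{\mu_{k,\ell}(\mathbb{Z}/e\mathbb{Z})\cdot\frac{n}{e}\right\},\ \left\lfloor\frac{n}{k+\ell}\right\rfloor\right\}, \] where the maxima over $e$ range over all positive divisors $e$ of $d$.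
   Context: For subsets $X,Y$ of an abelian group, $X+Y=\{x+y: x\in X, y\in Y\}$, and for an integer $j\ge 1$, $jX=X+\dots+X$ ($j$ copies); $0X=\{0\}$. A set $B$ in an abelian group $G$ is $(k,\ell)$-sum-free if $kB\cap \ell B=\emptyset$, and $\mu_{k,\ell}(G)$ is the maximum size of a $(k,\ell)$-sum-free subset of $G$ (so $\mu_{k,\ell}(\mathbb{Z}/1\mathbb{Z})=0$). For $A,C\subseteq \mathbb{Z}/n\mathbb{Z}$ and an integer $j\ge 1$, define $j *_C A = jA+(j-1)C$. A set $A\subseteq\mathbb{Z}/n\mathbb{Z}$ is $C$-$(k,\ell)$-sum-free if $(k *_C A)\cap(\ell *_C A)=\emptyset$. $\mu^C_{k,\ell}(\mathbb{Z}/n\mathbb{Z})$ denotes the maximum size of a $C$-$(k,\ell)$-sum-free subset of $\mathbb{Z}/n\mathbb{Z}$. *)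

(* Defs.v *)
(* Z/nZ (n >= 1) is modelled as the ordinal type 'I_n with
   addition (x + y) %% n; subsets of Z/nZ are {set 'I_n}. *)
From mathcomp Require Import all_boot all_order all_algebra.
Set Implicit Arguments. Unset Strict Implicit. Unset Printing Implicit Defensive.

Definition sumset (n : nat) (X Y : {set 'I_n}) : {set 'I_n} :=
  [set z : 'I_n | [exists x in X, exists y in Y, val z == (val x + val y) %% n]].

(* {0} in Z/nZ (empty only for the excluded n = 0) *)
Definition zeroset (n : nat) : {set 'I_n} := [set z : 'I_n | val z == 0].

Definition nfold (n j : nat) (X : {set 'I_n}) : {set 'I_n} :=
  iter j (fun Y => sumset Y X) (zeroset n).

Definition kl_sumfree (n k l : nat) (B : {set 'I_n}) : bool :=
  nfold k B :&: nfold l B == set0.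

Definition mu (n k l : nat) : nat :=
  \max_(B : {set 'I_n} | kl_sumfree k l B) #|B|.

Definition cstar (n : nat) (C : {set 'I_n}) (j : nat) (A : {set 'I_n}) : {set 'I_n} :=
  sumset (nfold j A) (nfold j.-1 C).

Definition C_kl_sumfree (n : nat) (C : {set 'I_n}) (k l : nat) (A : {set 'I_n}) : bool :=
  cstar C k A :&: cstar C l A == set0.

Definition muC (n : nat) (C : {set 'I_n}) (k l : nat) : nat :=
  \max_(A : {set 'I_n} | C_kl_sumfree C k l A) #|A|.

Definition C0s (n s : nat) : {set 'I_n} :=
  [set z : 'I_n | (val z == 0) || (val z == s %% n)].

(* Main.v *)
(* Upper bound: let A be C-(k,l)-sum-free, X = k *_C A, Y = l *_C A, and let H be
   the stabilizer of X - Y.  Since 0 is not in X - Y, H misses X - Y, and Kneser's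
   theorem applied to X - Y = kA + (k-1)C - lA - (l-1)C gives
     (k+l)|A+H| + (k+l-2)|C+H| <= n + 2(k+l-2)|H|.
   If s is not in H then |C+H| >= 2|H|, hence (k+l)|A| <= n.  If s is in H then
   e = n/|H| divides d, and A reduces modulo e to a (k,l)-sum-free set.
   Kneser's theorem is proved by the Dyson transform: it yields, for each c in A+B,
   a set C with c in C, C contained in A+B, and |C| + |stab C| >= |A| + |B|; these
   sets are glued together, the bound being preserved by unions.
   Lower bound: preimages modulo e | d of sum-free sets, and intervals [a, a+m),
   with a chosen so that (k-l)a hits a suitable multiple T of gcd(n, k-l). *)
Require Import Defs.
From mathcomp Require Import all_boot all_order all_algebra all_fingroup.
From mathcomp Require Import cyclic zify.
Set Implicit Arguments. Unset Strict Implicit. Unset Printing Implicit Defensive.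
(* Sumsets in Z/nZ are pointwise products in the additive finGroupType 'I_n,
   so group-theoretic statements below are written multiplicatively. *)
Local Open Scope group_scope.

(** * Periods of sets and Kneser's theorem in commutative groups *)

(** The stabilizer of [C] under right translation; taken as a normaliser for an action, it carries
    its group structure. *)
Definition period (gT : finGroupType) (C : {set gT}) : {group gT} := 'N(C | 'R)%G.

Lemma periodP (gT : finGroupType) (C : {set gT}) x :
  reflect (forall y, y \in C -> y * x \in C) (x \in period C).
Proof.
rewrite !inE; apply: (iffP subsetP) => H y yC; first by have := H y yC; rewrite inE.
by rewrite inE; apply: H.
Qed.

Lemma period_mem (gT : finGroupType) (C : {set gT}) x y :
  x \in period C -> (y * x \in C) = (y \in C).
Proof. by move=> xC; apply: (astabs_act (to := 'R) y xC). Qed.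

Lemma period_rcoset (gT : finGroupType) (C : {set gT}) b :
  (forall x y : gT, commute x y) -> period (C :* b) = period C :> {set gT}.
Proof.
move=> mC; apply/setP=> x; apply/periodP/periodP => H y yC.
  by rewrite -[y * x](mulgK b) -mem_rcoset -mulgA (mC x) mulgA H // mem_rcoset mulgK.
by rewrite mem_rcoset -mulgA (mC x) mulgA H // -mem_rcoset.
Qed.

(** Pairs with product [x0 * y0] have first coordinate in the coset of [H :&: K] through [x0], and
    that coordinate determines the pair. *)
Lemma leq_card_prod (gT : finGroupType) (H K : {group gT}) (X Y : {set gT}) :
  X \subset H -> Y \subset K -> (#|X| * #|Y| <= #|(X * Y)%g| * #|H :&: K|)%N.
Proof.
move=> XH YK; rewrite -cardsX -sum1_card.
rewrite (partition_big (fun p : gT * gT => p.1 * p.2) (mem (X * Y))) /=; last first.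
  by case=> x y /=; rewrite in_setX => /andP[xX yY]; apply/mulsgP; exists x y.
rewrite -sum_nat_const; apply: leq_sum => z /mulsgP[x0 y0 x0X y0Y ->].
rewrite sum1_card -(card_lcoset (H :&: K) x0).
set D := [set p in setX X Y | p.1 * p.2 == x0 * y0].
have -> : #|[pred p in setX X Y | p.1 * p.2 == x0 * y0]| = #|D|.
  by apply: eq_card => p; rewrite !inE.
have /card_in_imset <- : {in D &, injective fst}.
  move=> [x y] [x' y']; rewrite !inE /= => /andP[_ /eqP e1] /andP[_ /eqP e2] exx.
  by move: e2; rewrite -e1 -exx => /mulgI ->.
apply/subset_leq_card/subsetP => _ /imsetP[[x y] + ->]; rewrite !inE /=.
case/andP => /andP[xX yY] /eqP e; rewrite mem_lcoset.
have xH := subsetP XH; have yK := subsetP YK.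
rewrite inE groupM ?groupV ?xH //=.
have -> : x0^-1 * x = y0 * y^-1 by apply: (mulgI x0); rewrite mulKVg mulgA -e mulgK.
by rewrite groupM ?groupV ?yK.
Qed.

Lemma leq_card_stable (gT : finGroupType) (L : {group gT}) (U : {set gT}) :
  (forall x y, x \in U -> y \in L -> x * y \in U) -> U != set0 -> #|L| <= #|U|.
Proof.
move=> UL /set0Pn[x xU]; rewrite -(card_lcoset L x).
by apply/subset_leq_card/subsetP => _ /lcosetP[y yL ->]; apply: UL.
Qed.

(* With L = H1 :&: H2 (Hi the period of Ci), the coset c H1 H2 is a grid in which C1
   is a union of rows c y H1 and C2 a union of columns c x H2, each row meeting each
   column in #|L| points; U and V record the rows missed by C1 and the columns
   missed by C2. *)
Lemma union_grid (gT : finGroupType) (C1 C2 : {set gT}) (c : gT) :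
  (forall x y : gT, commute x y) -> c \in C2 :\: C1 ->
  [\/ #|period C1| <= #|C2 :\: C1| + #|period C1 :&: period C2|,
      #|period C2| <= #|C1 :\: C2| + #|period C1 :&: period C2|
    | #|period C2| + #|period C1 :&: period C2| < #|period C1| ].
Proof.
move=> mC; rewrite inE => /andP[cC1 cC2].
set H1 := period C1; set H2 := period C2; set l := #|_ :&: _|.
pose U := [set y in H2 | c * y \notin C1]; pose V := [set x in H1 | c * x \notin C2].
have in1 x y : x \in H1 -> (c * (x * y) \in C1) = (c * y \in C1).
  by move=> xH; rewrite (mC x) mulgA period_mem.
have in2 x y : y \in H2 -> (c * (x * y) \in C2) = (c * x \in C2).
  by move=> yH; rewrite mulgA period_mem.
have sU : U \subset H2 by apply/subsetP=> x; rewrite inE => /andP[].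
have sV : V \subset H1 by apply/subsetP=> x; rewrite inE => /andP[].
(* For [x] in [H1 :\: V] and [y] in [U], the point [c * (x * y)] lies in [C2 :\: C1]. *)
have D21 : ((#|H1| - #|V|) * #|U| <= #|C2 :\: C1| * l)%N.
  rewrite -(cardsDS sV); apply: leq_trans (leq_card_prod (subsetDl H1 V) sU) _.
  rewrite leq_mul2r; apply/orP; right; rewrite -(card_lcoset ((H1 :\: V) * U) c).
  apply/subset_leq_card/subsetP => _ /lcosetP[_ /mulsgP[x y + + ->] ->].
  rewrite in_setD [_ \in V]inE [_ \in U]inE => /andP[+ xH] /andP[yH cy].
  by rewrite xH negbK in_setD in1 // in2 // cy.
have D12 : (#|V| * (#|H2| - #|U|) <= #|C1 :\: C2| * l)%N.
  rewrite -(cardsDS sU); apply: leq_trans (leq_card_prod sV (subsetDl H2 U)) _.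
  rewrite leq_mul2r; apply/orP; right; rewrite -(card_lcoset (V * (H2 :\: U)) c).
  apply/subset_leq_card/subsetP => _ /lcosetP[_ /mulsgP[x y + + ->] ->].
  rewrite in_setD [_ \in V]inE [_ \in U]inE => /andP[xH cx] /andP[+ yH].
  by rewrite yH negbK in_setD in1 // in2 // cx.
have stU : l <= #|U|.
  apply: leq_card_stable; last by apply/set0Pn; exists 1; rewrite inE mulg1 group1.
  move=> x y; rewrite [y \in _]in_setI [x \in _]inE [_ \in U]inE => /andP[xH cx] /andP[y1 y2].
  by rewrite groupM // mulgA period_mem.
have stV : #|V| = 0 \/ l <= #|V|.
  have [->|nV] := eqVneq V set0; first by left; rewrite cards0.
  right; apply: leq_card_stable nV => x y.
  rewrite [y \in _]in_setI [x \in _]inE [_ \in V]inE => /andP[xH cx] /andP[y1 y2].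
  by rewrite groupM // mulgA period_mem.
have stV' : l <= #|H1| - #|V|.
  rewrite -(cardsDS sV); apply: leq_card_stable; last first.
    by apply/set0Pn; exists 1; rewrite in_setD [_ \in V]inE mulg1 group1 cC2.
  move=> x y; rewrite !in_setD [y \in _]in_setI [x \in V]inE => /andP[+ xH].
  rewrite xH negbK => cx /andP[y1 y2].
  by rewrite [_ \in V]inE groupM // mulgA period_mem // cx.
have stU' : #|H2| = #|U| \/ l <= #|H2| - #|U|.
  have [e|nU] := eqVneq (H2 :\: U) set0.
    left; apply/eqP; rewrite eqn_leq (subset_leq_card sU) andbT.
    by apply: subset_leq_card; rewrite -setD_eq0 e.
  right; rewrite -(cardsDS sU); apply: leq_card_stable nU.
  move=> x y; rewrite !in_setD [y \in _]in_setI [x \in U]inE => /andP[+ xH].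
  rewrite xH negbK => cx /andP[y1 y2].
  by rewrite [_ \in U]inE groupM // mulgA period_mem // cx.
have l0 : 0 < l by apply: cardG_gt0.
have leV := subset_leq_card sV; have leU := subset_leq_card sU.
move: D21 D12 stU stV stV' stU' l0 leV leU.
move: #|U| #|V| (#|H1|) (#|H2|) #|C2 :\: C1| #|C1 :\: C2| l.
clear => p q h1 h2 x y l D21 D12 lp q0 lq p0 l0 qh ph.
(* If the first two alternatives fail, [D21] excludes [q = 0]. Then [l <= h2 - p] would force
   [p < q] by [D21] and [q < p] by [D12]; so [h2 = p], and [D21] gives the third. *)
case: (leqP h1 (x + l)) => [?|hx]; first by constructor 1.
case: (leqP h2 (y + l)) => [?|hy]; first by constructor 2.
constructor 3; nia.
Qed.

(** [union_grid] is applied in both orders, and its third alternative cannot hold both times. Either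
    of the others says that the points gained in the union, together with the common period, make up
    for the period lost. *)
Lemma leq_period_union (gT : finGroupType) (C1 C2 : {set gT}) t :
  (forall x y : gT, commute x y) ->
  t <= #|C1| + #|period C1| -> t <= #|C2| + #|period C2| ->
  t <= #|C1 :|: C2| + #|period (C1 :|: C2)|.
Proof.
move=> mC t1 t2.
have [s12|/subsetPn[c1 c1C1 c1C2]] := boolP (C1 \subset C2); first by rewrite (setUidPr s12).
have [s21|/subsetPn[c2 c2C2 c2C1]] := boolP (C2 \subset C1); first by rewrite (setUidPl s21).
set l := #|period C1 :&: period C2|.
have leL : l <= #|period (C1 :|: C2)|.
  apply/subset_leq_card/subsetP => x; rewrite in_setI => /andP[x1 x2].
  by apply/periodP => y; rewrite !in_setU !period_mem.
have e1 : #|C1 :|: C2| = #|C1| + #|C2 :\: C1|.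
  by have := cardsUI C1 C2; have := cardsID C1 C2; rewrite setIC; lia.
have e2 : #|C1 :|: C2| = #|C2| + #|C1 :\: C2|.
  by have := cardsUI C1 C2; have := cardsID C2 C1; lia.
have := @union_grid gT C1 C2 c2 mC; rewrite in_setD c2C1 c2C2 => /(_ isT).
have := @union_grid gT C2 C1 c1 mC; rewrite in_setD c1C1 c1C2 => /(_ isT).
rewrite [period C2 :&: _]setIC -/l.
by case=> ?; case=> ?; lia.
Qed.

(* Replacing (A, B) by (A :|: e *: B, B :&: e^-1 *: A) preserves #|A| + #|B| and
   does not enlarge A * B; it stalls only when A is a union of cosets of <<B>>. *)
Lemma kneser_local (gT : finGroupType) (A B : {set gT}) a :
  (forall x y : gT, commute x y) -> a \in A -> 1 \in B ->
  exists C : {set gT},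
    [/\ C \subset A * B, a \in C & #|A| + #|B| <= #|C| + #|period C|].
Proof.
move=> mC; have [m] := ubnP #|B|; elim: m A B => // m IHm A B leBm aA B1.
have [/existsP[e /andP[eA neB]]|] := boolP [exists e in A, ~~ (e *: B \subset A)]; last first.
  rewrite negb_exists => /forallP stA; exists A; split=> //.
    by apply/subsetP => x xA; rewrite -[x]mulg1 mem_mulg.
  rewrite leq_add2l; apply/subset_leq_card/subsetP => b bB; apply/periodP => y yA.
  have := stA y; rewrite yA negbK /= => /subsetP; apply.
  by rewrite mem_lcoset mulKg.
pose A' := A :|: e *: B; pose B' := B :&: e^-1 *: A.
have cAB : #|A'| + #|B'| = #|A| + #|B|.
  (* Since [e *: B' = A :&: e *: B], this is inclusion-exclusion for [A] and [e *: B]. *)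
  rewrite -(card_lcoset B e) -[RHS]cardsUI -(card_lcoset B' e); congr (_ + _)%N.
  by apply: eq_card => x; rewrite mem_lcoset !in_setI !mem_lcoset invgK mulKVg andbC.
have [|||C [sC aC leC]] := IHm A' B'.
- rewrite -ltnS; apply: leq_trans leBm; rewrite ltnS; apply: proper_card.
  rewrite properE subsetIl /=; apply: contra neB => sBB'.
  apply/subsetP => _ /lcosetP[b bB ->].
  by have := subsetP sBB' b bB; rewrite in_setI bB mem_lcoset invgK.
- by rewrite in_setU aA.
- by rewrite in_setI B1 mem_lcoset invgK mulg1.
exists C; split=> //; last by rewrite -cAB.
apply: subset_trans sC _; apply/subsetP => _ /mulsgP[x y + + ->].
rewrite in_setU in_setI !mem_lcoset invgK => xA' /andP[yB eyA].
case/orP: xA' => [xA|]; first by rewrite mem_mulg.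
have -> : x * y = e * y * (e^-1 * x) by rewrite (mC x) (mC e) -mulgA mulKVg.
by apply: mem_mulg.
Qed.

(** A largest subset of [A * B] satisfying the bound is all of [A * B]: the local set around a
    missing point could be adjoined to it. *)
Lemma kneser_weak (gT : finGroupType) (A B : {set gT}) :
  (forall x y : gT, commute x y) -> A != set0 -> B != set0 ->
  #|A| + #|B| <= #|A * B| + #|period (A * B)|.
Proof.
move=> mC /set0Pn[a aA] /set0Pn[b bB].
have loc c : c \in A * B -> exists C : {set gT},
    [/\ C \subset A * B, c \in C & #|A| + #|B| <= #|C| + #|period C|].
  case/mulsgP=> x y xA yB ->.
  (* Translating [B] by [y^-1] puts [1] in it; translating back preserves sizes and periods. *)
  have [|C [sC xC leC]] := @kneser_local gT A (B :* y^-1) x mC xA.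
    by rewrite mem_rcoset invgK mul1g.
  exists (C :* y); split.
  - apply/subsetP => _ /rcosetP[z /(subsetP sC)/mulsgP[x' w x'A + ->] ->].
    by rewrite mem_rcoset invgK -mulgA => wB; rewrite mem_mulg.
  - by rewrite mem_rcoset mulgK.
  by rewrite period_rcoset // card_rcoset -(card_rcoset B y^-1).
have [C0 [s0 _ le0]] := loc _ (mem_mulg aA bB).
pose P (C : {set gT}) := (C \subset A * B) && (#|A| + #|B| <= #|C| + #|period C|).
have P0 : P C0 by rewrite /P s0.
case: (arg_maxnP (fun C : {set gT} => #|C|) P0) => C /andP[sC leC] maxC.
have [sABC|/subsetPn[c cAB cC]] := boolP (A * B \subset C).
  by have -> : A * B = C by apply/eqP; rewrite eqEsubset sABC.
have [C' [sC' cC' leC']] := loc c cAB.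
have := maxC (C :|: C'); rewrite /P subUset sC sC' leq_period_union //= => /(_ isT).
have : #|C| < #|C :|: C'|.
  apply: proper_card; rewrite properE subsetUl /=; apply: contra cC => /subsetP; apply.
  by rewrite in_setU cC' orbT.
by rewrite ltnNge => /negP nle /nle.
Qed.

Lemma mulsg_comm (gT : finGroupType) (X Y : {set gT}) :
  (forall x y : gT, commute x y) -> commute X Y.
Proof.
move=> mC; have sub (U V : {set gT}) : U * V \subset V * U.
  by apply/subsetP => _ /mulsgP[x y xU yV ->]; rewrite (mC x) mem_mulg.
by apply/eqP; rewrite eqEsubset !sub.
Qed.

Lemma mulsg_neq0 (gT : finGroupType) (X Y : {set gT}) :
  X != set0 -> Y != set0 -> X * Y != set0.
Proof.
by move=> /set0Pn[x xX] /set0Pn[y yY]; apply/set0Pn; exists (x * y); rewrite mem_mulg.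
Qed.

Lemma mulg_period (gT : finGroupType) (C : {set gT}) : C * period C = C.
Proof.
apply/eqP; rewrite eqEsubset mulg_subl ?group1 // andbT.
by apply/subsetP => _ /mulsgP[x y xC yH ->]; rewrite period_mem.
Qed.

(** Saturating both factors by [H] leaves the product [A * B] unchanged, so the weak form applies to
    [A * H] and [B * H]. *)
Theorem kneser (gT : finGroupType) (A B : {set gT}) (H := period (A * B)) :
  (forall x y : gT, commute x y) -> A != set0 -> B != set0 ->
  #|A * H| + #|B * H| <= #|A * B| + #|H|.
Proof.
move=> mC nA nB.
have nH (X : {set gT}) : X != set0 -> X * H != set0.
  by move=> nX; apply: mulsg_neq0 => //; apply/set0Pn; exists 1; apply: group1.
have := kneser_weak mC (nH A nA) (nH B nB).
have -> // : A * H * (B * H) = A * B.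
by rewrite (mulsg_comm B) // -mulgA (mulgA H) mulGid (mulsg_comm H) // mulgA mulg_period.
Qed.

(** * Kneser's inequality for many factors, applied to sum-free sets *)

(** The same [H] serves throughout the induction: being a factor of the tail [Q], it lies in
    [period Q], which lies in [period (A * Q) = H]. *)
Lemma kneser_prod (gT : finGroupType) (H : {group gT}) (s : seq {set gT}) :
  (forall x y : gT, commute x y) -> all (fun A => A != set0) s ->
  period ((\prod_(A <- s) A) * H) = H ->
  (#|H| + \sum_(A <- s) #|(A * H)%g| <=
    #|((\prod_(A <- s) A) * H)%g| + size s * #|H|)%N.
Proof.
move=> mC; elim: s => [|A s IHs] /=; first by rewrite !big_nil mul1g.
case/andP=> nA ns; rewrite !big_cons -mulgA; set Q := _ * H => pAQ.
have QH : Q * H = Q by rewrite -mulgA mulGid.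
have pQ : period Q = H.
  apply/val_inj/eqP; rewrite /= eqEsubset; apply/andP; split; apply/subsetP => x xH.
    rewrite -pAQ; apply/periodP => _ /mulsgP[a q aA qQ ->].
    by rewrite -mulgA mem_mulg // period_mem.
  by apply/periodP => y yQ; rewrite -QH mem_mulg.
have nQ : Q != set0.
  apply: mulsg_neq0; last by apply/set0Pn; exists 1; apply: group1.
  elim: s ns {IHs QH pQ pAQ Q} => [_|B s IHs /= /andP[nB ns]].
    by rewrite big_nil; apply/set0Pn; exists 1; apply: set11.
  by rewrite big_cons mulsg_neq0 // IHs.
have := IHs ns pQ; have := kneser mC nA nQ; rewrite pAQ QH.
have arith (a q h t u v : nat) : a + q <= u + h -> h + t <= q + v -> h + (a + t) <= u + (h + v).
  by lia.
by rewrite mulSn; apply: arith.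
Qed.

Lemma prod_nseqg (gT : finGroupType) j (X : {set gT}) : \prod_(Y <- nseq j X) Y = X ^+ j.
Proof. by elim: j => [|j IHj] /=; rewrite ?big_nil ?big_cons ?expg0 // IHj expgS. Qed.

Lemma invsg_exp (gT : finGroupType) j (X : {set gT}) : (X ^+ j)^-1 = X^-1 ^+ j.
Proof. by elim: j => [|j IHj]; rewrite ?expg0 ?invg1 // expgS invMg IHj -expgSr. Qed.

Lemma mulVsg_disjoint (gT : finGroupType) (X Y : {set gT}) :
  X :&: Y = set0 -> 1 \notin X * Y^-1.
Proof.
move=> XY0; apply/negP => /mulsgP[x y xX]; rewrite inE => yY e.
have exy : x = y^-1 by apply: (mulIg y); rewrite mulVg e.
by have := in_set0 x; rewrite -XY0 in_setI xX exy yY.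
Qed.

Lemma period_disjoint (gT : finGroupType) (Z : {set gT}) :
  1 \notin Z -> period Z :&: Z = set0.
Proof.
move=> Z1; apply/setP => x; rewrite in_setI in_set0; apply/andP => -[xH xZ].
have : x * x^-1 \in Z by rewrite period_mem // groupV.
by rewrite mulgV (negPf Z1).
Qed.

(** Avoiding [1], the set [Z] is disjoint from its period, so [#|Z| + #|H| <= #|gT|]; this is
    combined with [kneser_prod] for [2 * (k + l) - 2] factors. *)
Lemma card_sumfree_period (gT : finGroupType) (A C : {set gT}) k l
    (Z := A ^+ k * C ^+ k.-1 * (A ^+ l * C ^+ l.-1)^-1) (H := period Z) :
  (forall x y : gT, commute x y) -> A != set0 -> C != set0 -> 0 < k -> 0 < l ->
  1 \notin Z ->
  ((k + l) * #|(A * H)%g| + (k + l - 2) * #|(C * H)%g| <= #|gT| + (k + l - 2) * 2 * #|H|)%N.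
Proof.
move=> mC nA nC k0 l0 Z1.
have nV (X : {set gT}) : X != set0 -> X^-1 != set0.
  by case/set0Pn => x xX; apply/set0Pn; exists x^-1; rewrite inE invgK.
pose s := nseq k A ++ nseq k.-1 C ++ nseq l.-1 C^-1 ++ nseq l A^-1.
have prodZ : \prod_(X <- s) X = Z.
  by rewrite !big_cat /= !prod_nseqg /Z invMg !invsg_exp !mulgA.
have ZH : Z * H = Z by apply: mulg_period.
have cV (X : {set gT}) : #|X^-1 * H| = #|X * H|.
  by rewrite -[in LHS](invGid H) -invMg card_invg mulsg_comm.
have := @kneser_prod gT H s mC; rewrite prodZ ZH !all_cat !all_nseq nA nC !nV // !orbT.
move=> /(_ isT erefl); rewrite !big_cat /= !big_nseq !cV !size_cat !size_nseq.
rewrite !iter_addn_0.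
have : #|Z| + #|H| <= #|gT|.
  rewrite addnC -cardsUI period_disjoint // cards0 addn0 -cardsT.
  by apply/subset_leq_card/subsetP => x _; rewrite inE.
have arith (z h g a c : nat) : z + h <= g ->
    (h + (a * k + (c * k.-1 + (c * l.-1 + a * l))) <= z + (k + (k.-1 + (l.-1 + l))) * h)%N ->
    ((k + l) * a + (k + l - 2) * c <= g + (k + l - 2) * 2 * h)%N.
  clear -k0 l0; case: k k0 => // k _; case: l l0 => // l _.
  have -> : k.+1 + l.+1 - 2 = k + l by lia.
  by rewrite /=; nia.
exact: arith.
Qed.

(** * Sumsets in Z/nZ as group products, and reduction modulo a divisor *)

Lemma sumsetE n (X Y : {set 'I_n.+1}) : sumset X Y = X * Y.
Proof.
apply/setP => z; rewrite inE; apply/existsP/mulsgP.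
  case=> x /andP[xX /existsP[y /andP[yY /eqP e]]]; exists x y => //.
  by apply: val_inj.
by case=> x y xX yY ->; exists x; rewrite xX; apply/existsP; exists y; rewrite yY /=.
Qed.

Lemma nfoldE n j (X : {set 'I_n.+1}) : nfold j X = X ^+ j.
Proof.
elim: j => [|j IHj].
  by apply/setP => z; rewrite expg0 !inE.
by rewrite /nfold iterS -/(nfold j X) IHj sumsetE expgSr.
Qed.

Lemma cstarE n (C A : {set 'I_n.+1}) j : cstar C j A = A ^+ j * C ^+ j.-1.
Proof. by rewrite /cstar sumsetE !nfoldE. Qed.

Lemma commute_ord n (x y : 'I_n.+1) : commute x y.
Proof. exact: zmodp.Zp_addC. Qed.

Lemma imset_mulg (gT rT : finGroupType) (f : gT -> rT) (X Y : {set gT}) :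
  {morph f : x y / x * y} -> f @: (X * Y) = f @: X * f @: Y.
Proof.
move=> fM; apply/setP => z; apply/imsetP/mulsgP.
  by case=> _ /mulsgP[x y xX yY ->] ->; exists (f x) (f y); rewrite ?imset_f.
case=> _ _ /imsetP[x xX ->] /imsetP[y yY ->] ->.
by exists (x * y); rewrite ?fM ?mem_mulg.
Qed.

Lemma imset_expg (gT rT : finGroupType) (f : gT -> rT) (X : {set gT}) j :
  {morph f : x y / x * y} -> f @: (X ^+ j) = (f @: X) ^+ j.
Proof.
move=> fM; have f1 : f 1 = 1 by apply: (mulIg (f 1)); rewrite -fM !mul1g.
by elim: j => [|j IHj]; rewrite ?expg0 ?imset_set1 ?f1 // !expgS imset_mulg ?IHj.
Qed.

Lemma expsgS (gT : finGroupType) (X Y : {set gT}) j : X \subset Y -> X ^+ j \subset Y ^+ j.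
Proof. by move=> sXY; elim: j => [|j IHj]; rewrite ?expg0 // !expgS mulgSS. Qed.

Lemma inZp_morph n e : e.+1 %| n.+1 ->
  {morph (fun x : 'I_n.+1 => zmodp.inZp x : 'I_e.+1) : x y / x * y}.
Proof. by move=> en x y; apply: val_inj; rewrite /= modn_dvdm // modnDm. Qed.

Lemma kl_sumfreeE n k l (B : {set 'I_n.+1}) :
  kl_sumfree k l B = (B ^+ k :&: B ^+ l == set0).
Proof. by rewrite /kl_sumfree !nfoldE. Qed.

Lemma mem_C0s0 n s : 1 \in C0s n.+1 s.
Proof. by rewrite inE. Qed.

Lemma mem_C0ss n s : (zmodp.inZp s : 'I_n.+1) \in C0s n.+1 s.
Proof. by rewrite inE eqxx orbT. Qed.

(** * Lower bound from preimages of sum-free sets *)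

(** Modulo [e.+1] the set {0, s} collapses to {0}, so for the preimage [A] of [B] the set
    [cstar _ j A] reduces into the [j]-fold sumset of [B]. *)
Lemma mu_lift_leq n e k l s : e.+1 %| n.+1 -> e.+1 %| s ->
  (mu e.+1 k l * (n.+1 %/ e.+1) <= muC (C0s n.+1 s) k l)%N.
Proof.
move=> en es; have q0 : 0 < n.+1 %/ e.+1 by rewrite divn_gt0 // dvdn_leq.
rewrite -leq_divRL //; apply/bigmax_leqP => B; rewrite kl_sumfreeE => /eqP Bkl.
rewrite leq_divRL //.
set f := fun x : 'I_n.+1 => zmodp.inZp x : 'I_e.+1.
have fM := inZp_morph en : {morph f : x y / x * y}.
pose A := f @^-1: B.
have fA : f @: A \subset B by apply/subsetP => _ /imsetP[x + ->]; rewrite inE.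
have fC : f @: C0s n.+1 s = 1.
  apply/setP => z; apply/imsetP/set1P.
    case=> x; rewrite inE => xC ->; apply: val_inj => /=.
    case/orP: xC => /eqP ->; first by rewrite mod0n.
    by apply/eqP; rewrite modn_dvdm.
  by move=> ->; exists 1; rewrite ?mem_C0s0 //; apply: val_inj; rewrite /= mod0n.
have fcstar j : f @: cstar (C0s n.+1 s) j A \subset B ^+ j.
  rewrite cstarE imset_mulg // !imset_expg // fC expg1n mulg1; exact: expsgS.
have sfA : C_kl_sumfree (C0s n.+1 s) k l A.
  apply/eqP/setP => x; rewrite in_setI in_set0; apply/andP => -[xk xl].
  have := in_set0 (f x); rewrite -Bkl in_setI.
  by rewrite (subsetP (fcstar k)) ?imset_f // (subsetP (fcstar l)) ?imset_f.
rewrite /muC (bigD1 A) //=; apply: leq_trans (leq_maxl _ _).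
(* [g] lists the lifts of each residue, injecting [B] times the range of quotients into [A]. *)
pose g (p : 'I_e.+1 * 'I_(n.+1 %/ e.+1)) : 'I_n.+1 := inord (p.1 + p.2 * e.+1).
have gE p : g p = p.1 + p.2 * e.+1 :> nat.
  rewrite inordK //; have := ltn_ord p.1; have := ltn_ord p.2.
  rewrite leq_divRL // => h1 h2; rewrite mulSn in h1; lia.
rewrite -[X in (_ * X)%N]card_ord -cardsT -cardsX -(card_in_imset (f := g)).
  apply/subset_leq_card/subsetP => _ /imsetP[[b q] + ->].
  rewrite in_setX => /andP[bB _]; rewrite inE.
  suff -> : f (g (b, q)) = b by [].
  by apply: val_inj; rewrite /= gE /= addnC modnMDl modn_small.
move=> [b q] [b' q'] _ _ /(congr1 val); rewrite /= !gE /= => e1.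
have eb : b = b' :> nat.
  by move/(congr1 (fun x => x %% e.+1)): e1; rewrite ![_ + _ * _]addnC !modnMDl !modn_small.
move: e1; rewrite eb => /addnI/eqP; rewrite eqn_pmul2r // => /eqP eq.
by congr pair; apply: val_inj.
Qed.

(** * Upper bound *)

(** By Lagrange [#|H|] kills [H], so [H] consists of multiples of [n.+1 %/ #|H|]; there are at most
    [#|H|] of these, which forces equality. *)
Lemma mem_subgroup_ord n (H : {group 'I_n.+1}) x :
  (x \in H) = (n.+1 %/ #|H| %| x).
Proof.
have Hn : #|H| %| n.+1 by have := cardSg (subsetT H); rewrite cardsT card_ord.
set e := n.+1 %/ #|H|; have eH : (e * #|H| = n.+1)%N by rewrite divnK.
have e0 : 0 < e by move: eH; case: (e).
pose S := [set x : 'I_n.+1 | e %| x].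
suff -> : H = S :> {set _} by rewrite inE.
apply/eqP; rewrite eqEcard; apply/andP; split.
  apply/subsetP => y yH; rewrite inE -(@dvdn_pmul2r #|H|) ?cardG_gt0 // eH.
  have /(congr1 val) : y ^+ #|H| = 1.
    by apply/eqP; rewrite -order_dvdn order_dvdG.
  by rewrite zmodp.Zp_expg /= => /eqP.
rewrite -[#|H|]prednK ?cardG_gt0 //.
pose g (x : 'I_n.+1) : 'I_(#|H|.-1).+1 := inord (x %/ e).
have gE y : g y = y %/ e :> nat.
  by rewrite inordK // prednK ?cardG_gt0 // ltn_divLR // mulnC eH.
rewrite -(card_in_imset (f := g) (D := S)); last first.
  move=> y z; rewrite !inE => ey ez /(congr1 val); rewrite /= !gE => eyz.
  by apply: val_inj; rewrite /= -(divnK ey) -(divnK ez) eyz.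
by apply: leq_trans (max_card _) _; rewrite card_ord.
Qed.

Lemma leq_card_sumfree n k l s (A : {set 'I_n.+1}) : 0 < k -> 0 < l ->
  C_kl_sumfree (C0s n.+1 s) k l A ->
  #|A| <= n.+1 %/ (k + l) \/
  exists e, [/\ e.+1 %| n.+1, e.+1 %| s & (#|A| <= mu e.+1 k l * (n.+1 %/ e.+1))%N].
Proof.
move=> k0 l0; rewrite /C_kl_sumfree !cstarE => /eqP/mulVsg_disjoint Z1.
have [->|nA] := eqVneq A set0; first by left; rewrite cards0.
set C := C0s n.+1 s in Z1.
have nC : C != set0 by apply/set0Pn; exists 1; apply: mem_C0s0.
have := @card_sumfree_period _ A C k l (@commute_ord n) nA nC k0 l0 Z1.
set Z := _ * (_)^-1 in Z1 *; set H := period Z; rewrite card_ord => bnd.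
have C1j j : 1 \in C ^+ j.
  by elim: j => [|j IHj]; rewrite ?expg0 ?set11 // expgS -[1]mul1g mem_mulg ?mem_C0s0.
have [sH|sH] := boolP ((zmodp.inZp s : 'I_n.+1) \in H); last first.
  left; rewrite leq_divRL ?addn_gt0 ?k0 // mulnC.
  have AH : #|A| <= #|A * H| by apply/subset_leq_card/mulg_subl/group1.
  (* [H] and its coset through [s] are disjoint and both lie in [C * H]. *)
  have CH : 2 * #|H| <= #|C * H|.
    rewrite mul2n -addnn -{2}(card_lcoset H (zmodp.inZp s)) -cardsUI.
    rewrite [_ :&: _](_ : _ = set0) ?cards0 ?addn0.
      apply/subset_leq_card/subsetP => x; rewrite in_setU => /orP[xH|/lcosetP[y yH ->]].
        by rewrite -[x]mul1g mem_mulg ?mem_C0s0.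
      by rewrite mem_mulg ?mem_C0ss.
    apply/setP => x; rewrite in_setI in_set0 mem_lcoset; apply/andP => -[xH].
    by rewrite groupMr // groupV (negPf sH).
  (* The term [u * c] absorbs the excess [u * 2 * h]. *)
  have arith (a a' c h m u N : nat) : a <= a' -> 2 * h <= c -> m * a' + u * c <= N + u * 2 * h ->
    m * a <= N by move=> *; nia.
  exact: arith AH CH bnd.
right; set e := n.+1 %/ #|H|.
have Hn : #|H| %| n.+1 by have := cardSg (subsetT H); rewrite cardsT card_ord.
have eH : (e * #|H| = n.+1)%N by rewrite divnK.
have e0 : 0 < e by move: eH; case: (e).
have en : e %| n.+1 by rewrite -eH dvdn_mulr.
have es : e %| s by move: sH; rewrite mem_subgroup_ord -/e /= /dvdn modn_dvdm.
have memH x : (x \in H) = (e %| x) by apply: mem_subgroup_ord.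
move: (e) e0 eH en es memH => [] // e' _ eH en es memH {e}.
exists e'; split=> //; set f := fun x : 'I_n.+1 => zmodp.inZp x : 'I_e'.+1.
have fM := inZp_morph en : {morph f : x y / x * y}.
have f1 : f 1 = 1 by apply: (mulIg (f 1)); rewrite -fM !mul1g.
have sfB : kl_sumfree k l (f @: A).
  rewrite kl_sumfreeE -!imset_expg //; apply/eqP/setP => z; rewrite in_setI in_set0.
  apply/andP => -[/imsetP[x xk ->] /imsetP[y yl fxy]].
  (* The difference of [x] and [y] would lie in [H], being 0 modulo [e'.+1], and in [Z], because [1]
     belongs to every power of [C]. *)
  have /setP/(_ (x * y^-1)) := period_disjoint Z1; rewrite in_setI in_set0 => /negP; apply.
  apply/andP; split; last first.
    rewrite mem_mulg //; last rewrite inE invgK; rewrite -[X in X \in _]mulg1 mem_mulg //.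
  rewrite -/H memH.
  have /(congr1 val) : f (x * y^-1) = 1.
    by apply: (mulIg (f y)); rewrite -fM mulgKV mul1g.
  by rewrite /= => /eqP.
pose q := n.+1 %/ e'.+1.
have qP (x : 'I_n.+1) : x %/ e'.+1 < q by rewrite ltn_divLR // divnK.
(* Residue and quotient determine [x], so [A] has at most [q] elements over each residue. *)
pose g x := (f x, Ordinal (qP x)).
apply: leq_trans (_ : #|f @: A| * q <= _); last first.
  by rewrite leq_mul2r /mu (bigD1 (f @: A)) //= leq_maxl orbT.
rewrite -[X in (_ * X)%N]card_ord -cardsT -cardsX -(card_in_imset (f := g) (D := A)).
  by apply/subset_leq_card/subsetP => _ /imsetP[x xA ->]; rewrite in_setX imset_f ?inE.
move=> x y _ _ [exy dxy]; apply: val_inj => /=.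
by rewrite (divn_eq x e'.+1) (divn_eq y e'.+1) exy dxy.
Qed.

(** * Lower bound from intervals *)

Lemma mem_expg_interval n (X : {set 'I_n.+1}) b w j :
  (forall x, x \in X -> exists2 t, t <= w & x = (b + t) %% n.+1 :> nat) ->
  forall x, x \in X ^+ j -> exists2 t, t <= j * w & x = (j * b + t)%N %% n.+1 :> nat.
Proof.
move=> XP; elim: j => [|j IHj] x.
  by rewrite expg0 => /set1P ->; exists 0; rewrite //= mod0n.
rewrite expgS => /mulsgP[y z /XP[t tw ey] /IHj[u uw ez] ->]; exists (t + u).
  by rewrite mulSn leq_add.
by rewrite /= ey ez modnDm mulSn addnACA.
Qed.

(* T stands for (k - l) a, and the two inequalities say that the intervals containing
   k *_C A and l *_C A do not wrap around onto each other; here #|A| = N - (s - 1). *)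
Lemma interval_leq_muC n k l s N T : l < k -> 0 < l -> 0 < s -> s <= N ->
  gcdn n.+1 (k - l) %| T -> (l * N <= T + (s - 1))%N -> (T + k * N <= n.+1 + (s - 1))%N ->
  N - (s - 1) <= muC (C0s n.+1 s) k l.
Proof.
move=> lk l0 s0 sN dvT lN kN.
(* Bezout: a multiple of [gcdn n.+1 (k - l)] is a multiple of [k - l] modulo [n.+1]. *)
have [a [c ac]] : exists a c : nat, (a * (k - l) = c * n.+1 + T)%N.
  have kl0 : 0 < k - l by rewrite subn_gt0.
  case/dvdnP: dvT => t ->; case: (egcdnP n.+1 kl0) => u v uv _.
  exists (t * u)%N, (t * v)%N; rewrite -mulnA uv gcdnC; lia.
set m := N - (s - 1).
pose g (i : 'I_m) : 'I_n.+1 := zmodp.inZp (a + i).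
pose A := g @: setT.
have k0 : 0 < k by apply: leq_ltn_trans lk.
have m_le : m <= n.+1 by have := leq_pmull N k0; rewrite /m; lia.
have msN : m.-1 + s = N by rewrite /m; lia.
have cA : #|A| = m.
  rewrite card_in_imset ?cardsT ?card_ord // => i j _ _ /(congr1 val) /= /eqP.
  rewrite eqn_modDl !modn_small; try by apply: leq_trans m_le.
  by move/eqP/val_inj.
have AP x : x \in A -> exists2 t, t <= m.-1 & x = (a + t) %% n.+1 :> nat.
  by case/imsetP=> i _ ->; exists i => //; have := ltn_ord i; lia.
have CP x : x \in C0s n.+1 s -> exists2 t, t <= s & x = (0 + t) %% n.+1 :> nat.
  rewrite inE => /orP[]/eqP ->; first by exists 0; rewrite // mod0n.
  by exists s; rewrite // add0n.
have cP j x : x \in cstar (C0s n.+1 s) j A ->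
    exists2 t, t <= j * m.-1 + j.-1 * s & x = (j * a + t)%N %% n.+1 :> nat.
  rewrite cstarE => /mulsgP[y z].
  move=> /(mem_expg_interval AP)[t tw ey] /(mem_expg_interval CP)[u uw ez] ->.
  exists (t + u); first exact: leq_add.
  by rewrite /= ey ez modnDm muln0 add0n addnA.
have sfA : C_kl_sumfree (C0s n.+1 s) k l A.
  apply/eqP/setP => x; rewrite in_setI in_set0; apply/andP => -[/cP[t tw ex] /cP[u uw]].
  rewrite ex => /eqP.
  have -> : (k * a + t = l * a + (a * (k - l) + t))%N.
    by rewrite addnA (mulnC a) -mulnDl subnKC // ltnW.
  rewrite eqn_modDl ac -addnA modnMDl.
  (* Offsets in [j *_C A] run up to [j * N - s]. Measured from [l * a], those for [l] stay below
     [T], and those for [k] lie between [T] and [n], so no two agree modulo [n.+1]. *)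
  have width j : 0 < j -> (j * m.-1 + j.-1 * s + s = j * N)%N.
    by case: j => // j _; rewrite -msN mulnDr -addnA -mulSnr.
  have := width k k0; have := width l l0 => wl wk.
  rewrite !modn_small; lia.
by rewrite -cA /muC (bigD1 A) //= leq_maxl.
Qed.

(** Given [N], the largest multiple [T] of [delta] with [T + k * N <= n.+1 + (s - 1)] is obtained by
    subtracting a remainder [r']; the other interval condition then reads
    [N * (k + l) + r' <= W]. *)
Lemma interval_remainder_leq_muC n k l s (W delta : nat) (r : int) :
  l < k -> 0 < l -> 0 < s ->
  W = n.+1 + 2 * (s - 1) -> delta = gcdn n.+1 (k - l) ->
  r = ((- (k * (W %/ (k + l)))%N%:Z + (s - 1)%:Z) %% delta%:Z)%Z ->
  (((W%:Z - r) %/ (k + l)%:Z)%Z - (s - 1)%:Z <= (muC (C0s n.+1 s) k l)%:Z)%R.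
Proof.
move=> lk l0 s0 WE dE rE.
have d0 : 0 < delta by rewrite dE gcdn_gt0.
have dk : delta <= k - l by rewrite dE; apply: dvdn_leq; rewrite ?subn_gt0 ?dvdn_gcdr.
have remP (x : int) : (0 <= (x %% delta%:Z)%Z)%R /\ ((x %% delta%:Z)%Z < delta%:Z)%R.
  by split; [apply: modz_ge0 | apply: ltz_pmod]; clear -d0; lia.
have [r0 rd] : (0 <= r)%R /\ (r < delta%:Z)%R by rewrite rE; apply: remP.
have NzW : (((W%:Z - r) %/ (k + l)%:Z)%Z * (k + l)%:Z <= W%:Z - r)%R.
  by apply: lez_floor; clear -l0; lia.
move: ((_ %/ _)%Z) NzW => Nz NzW.
(* When the quotient is at most [s - 1], possibly negative, the left side is at most 0. *)
have [Nz_s|s_Nz] := Num.Theory.lerP Nz (Posz (s - 1)); first by clear -Nz_s; lia.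
have [N NE] : exists N : nat, Nz = Posz N by exists `|Nz|%N; clear -s_Nz; lia.
rewrite {}NE {Nz} in NzW s_Nz *.
have sN : s <= N by clear -s_Nz; lia.
(* [r'] is the remainder [r] recomputed with [N] in place of [W %/ (k + l)]. *)
have [r' r'E] : exists r', r' = ((- (k * N)%N%:Z + (s - 1)%:Z) %% delta%:Z)%Z by eexists.
have [r'0 r'd] : (0 <= r')%R /\ (r' < delta%:Z)%R by rewrite r'E; apply: remP.
have Nr' : ((N * (k + l))%N%:Z + r' <= W%:Z)%R.
  have [Nq|Nq] := eqVneq N (W %/ (k + l)).
    have -> : r' = r by rewrite r'E rE Nq.
    by clear -NzW; lia.
  (* The remainder may change when N drops below the floor, but the slack k + l
     exceeds delta. *)
  have {}Nq : N.+1 <= W %/ (k + l).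
    rewrite ltn_neqAle Nq leq_divRL ?addn_gt0 ?l0 ?orbT //.
    by clear -NzW r0; lia.
  have := leq_trans (leq_mul Nq (leqnn (k + l))) (leq_trunc_div W (k + l)).
  by rewrite mulSn; clear -r'd dk; lia.
have kN : (k * N <= k * N + l * N)%N := leq_addr _ _.
have NkN : N <= l * N by rewrite leq_pmull.
have NkNl : (N * (k + l) = k * N + l * N)%N by rewrite mulnDr !(mulnC N).
rewrite NkNl in Nr'.
have [T TE] : exists T : nat, (Posz T = n.+1%:Z - (k * N)%N%:Z + (s - 1)%:Z - r')%R.
  by exists `|(n.+1%:Z - (k * N)%N%:Z + (s - 1)%:Z - r')%R|%N; clear -Nr' WE NkN sN; lia.
suff : N - (s - 1) <= muC (C0s n.+1 s) k l by clear -sN; lia.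
apply: (@interval_leq_muC n k l s N T) => //; [|by clear -Nr' WE TE; lia|by clear -r'0 TE; lia].
rewrite -dE; suff : (delta%:Z %| T%:Z)%Z by [].
have -> : (T%:Z = n.+1%:Z + ((- (k * N)%N%:Z + (s - 1)%:Z) %/ delta%:Z)%Z * delta%:Z)%R.
  have := divz_eq (- (k * N)%N%:Z + (s - 1)%:Z)%R delta%:Z; rewrite -r'E TE.
  by move: ((_ %/ _)%Z * _)%R => x; clear; lia.
by rewrite GRing.rpredD ?dvdz_mull // dE; apply: dvdn_gcdl.
Qed.

(* Assembly of the two bounds *)
Local Close Scope group_scope.
Import Order.TTheory GRing.Theory Num.Theory.

Theorem theorem2 (n k l s : nat) (hn : 1 <= n) (hlk : l < k) (hl : 1 <= l) (hs : 1 <= s) :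
  let d := gcdn s n in
  let M := \max_(e <- divisors d) (mu e k l * (n %/ e)) in
  let delta := gcdn n (k - l) in
  let r : int :=
    ((- ((k * ((n + 2 * (s - 1)) %/ (k + l)))%N)%:Z + (s - 1)%:Z) %% delta%:Z)%Z in
  (Num.max (M%:Z) (((((n + 2 * (s - 1))%N)%:Z - r) %/ (k + l)%:Z)%Z - (s - 1)%:Z)
     <= (muC (C0s n s) k l)%:Z)%R
  /\ muC (C0s n s) k l <= maxn M (n %/ (k + l)).
Proof.
move=> d M delta r; case: n hn @d @M @delta @r => // n _ d M delta r.
have d0 : 0 < d by rewrite gcdn_gt0 orbT.
have k0 : 0 < k by apply: leq_ltn_trans hlk.
split.
  rewrite ge_max; apply/andP; split; last first.
    exact: interval_remainder_leq_muC hlk hl hs erefl erefl erefl.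
  rewrite lez_nat; apply/bigmax_leqP_seq => e; rewrite -dvdn_divisors // dvdn_gcd => /andP[es en] _.
  case: e es en => [|e] es en; first by rewrite dvd0n in en.
  exact: mu_lift_leq.
apply/bigmax_leqP => A /(leq_card_sumfree k0 hl)[leA|[e [en es leA]]].
  by rewrite leq_max leA orbT.
rewrite leq_max; apply/orP; left; apply: leq_trans leA _.
apply: (leq_bigmax_seq (F := fun e => mu e k l * (n.+1 %/ e))) => //.
by rewrite -dvdn_divisors // dvdn_gcd es.
Qed.
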